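(* Let $\lambda,c>0$ and $a<b$ be real numbers. Let $\{X(t)\}_{t\ge 0}$ be the telegraph process with velocity $c$ and switching rate $\lambda$, let $D(t)\in\{d_0,d_1\}$ be its direction at time $t$ ($d_0$ = right, $d_1$ = left), and let $\tau=\inf\{t>0:\ X(t)\notin[a,b]\}$. For $x\in[a,b]$ and $j=0,1$ put $$u_j(x)=\mathbb{P}\big(X(\tau)=b\,\big|\,X(0)=x,\ D(0)=d_j\big),\qquad u(x)=\mathbb{P}\big(X(\tau)=b\,\big|\,X(0)=x\big)=\frac{u_0(x)+u_1(x)}{2}.$$ Then for every $x\in[a,b]$, $$u_0(x)=\frac{c+\lambda(x-a)}{c+\lambda(b-a)},\qquad u_1(x)=\frac{\lambda(x-a)}{c+\lambda(b-a)},$$ and consequently $$u(x)=\frac12\,\frac{c+2\lambda(x-a)}{c+\lambda(b-a)}.$$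
   Context: Telegraph process: a particle starts at $X(0)=x\in\mathbb{R}$ and at time $0$ starts moving rightwards (direction $d_0$) or leftwards (direction $d_1$), each with probability $\frac12$. It moves along the real line with constant speed $c>0$ and reverses its direction at each event of a homogeneous Poisson process $N(t)$ with intensity $\lambda>0$, independent of the initial direction. $D(t)$ denotes the direction at time $t$. In particular, if the process starts at $b$ with direction $d_0$, or at $a$ with direction $d_1$, then $\tau=0$ and the process exits immediately through its starting point. *)

(* Defs.v *)
From HB Require Import structures.
From mathcomp Require Import all_boot all_order all_algebra.
From mathcomp Require Import all_classical all_reals all_analysis.

Set Implicit Arguments.
Unset Strict Implicit.
Unset Printing Implicit Defensive.

Import Order.TTheory GRing.Theory Num.Theory.
Import numFieldNormedType.Exports.

Local Open Scope classical_set_scope.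
Local Open Scope ring_scope.

(* Directions are bits, so that [d_j] is the bit [j] and a reversal is a
   negation. *)
Definition direction : Type := bool.
Definition d0 : direction := false.
Definition d1 : direction := true.

Definition sign_of {R : realType} (d : direction) : R :=
  if d is false then 1 else -1.

(* P(A | B) for an event B of positive probability. *)
Definition cond_prob {R : realType} {dd : measure_display}
    {Omega : measurableType dd} (P : probability Omega R) (A B : set Omega) : R :=
  fine (P (A `&` B)) / fine (P B).

(* The sets [A i] may be the whole space, so this covers every subfamily. *)
Definition mutually_independent {R : realType} {dd dd' : measure_display}
    {Omega : measurableType dd} {T : measurableType dd'}
    (P : probability Omega R) (n : nat) (Y : 'I_n -> Omega -> T) : Prop :=
  forall A : 'I_n -> set T, (forall i, measurable (A i)) ->
    P (\bigcap_i (Y i @^-1` A i)) = (\prod_(i < n) P (Y i @^-1` A i))%E.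

Definition independent_families {R : realType} {dd : measure_display}
    {Omega : measurableType dd} (P : probability Omega R)
    (F G : set (set Omega)) : Prop :=
  forall A B, F A -> G B -> P (A `&` B) = (P A * P B)%E.

(* The sigma-algebra generated by a process indexed by [0, +oo). *)
Definition sigma_process {R : realType} {dd dd' : measure_display}
    {Omega : measurableType dd} {T : measurableType dd'}
    (N : R -> Omega -> T) : set (set Omega) :=
  <<s \bigcup_(t in [set t | 0 <= t])
        preimage_set_system setT (N t) measurable >>.

(* [N t w] matters only for [0 <= t].  The regularity of the paths is required
   for every outcome.  Increments are natural-number differences, which do not
   truncate since the paths are nondecreasing.  The Poisson law is required on
   intervals of positive length only: [poisson_pmf r] is the Poisson mass
   function for [0 < r] but not for [r = 0]. *)
Record poisson_process {R : realType} {dd : measure_display}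
    {Omega : measurableType dd} (P : probability Omega R) (lambda : R)
    (N : R -> Omega -> nat) : Prop := PoissonProcess {
  poisson_measurable : forall t, 0 <= t -> measurable_fun setT (N t) ;
  poisson_start : forall w, N 0 w = 0%N ;
  poisson_nondecreasing : forall w s t, 0 <= s -> s <= t -> (N s w <= N t w)%N ;
  poisson_right_continuous : forall w t, 0 <= t ->
    N s w @[s --> t^'+] --> N t w ;
  poisson_independent_increments : forall (n : nat) (t : nat -> R),
    0 <= t 0%N -> nondecreasing_seq t ->
    mutually_independent P
      (fun (i : 'I_n) w => (N (t i.+1) w - N (t i) w)%N) ;
  poisson_increment_law : forall s t k, 0 <= s -> s < t ->
    P [set w | (N t w - N s w)%N = k] = (poisson_pmf (lambda * (t - s)) k)%:E
}.

(* Conditioning on X(0) = x is starting the process at the given point [x]. *)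
Record telegraph_process {R : realType} {dd : measure_display}
    {Omega : measurableType dd} (P : probability Omega R) (lambda c x : R)
    (N : R -> Omega -> nat) (D : R -> Omega -> direction)
    (X : R -> Omega -> R) : Prop := TelegraphProcess {
  telegraph_poisson : poisson_process P lambda N ;
  telegraph_start_measurable : measurable_fun setT (D 0 : Omega -> bool) ;
  telegraph_start_law : forall j : direction,
    P [set w | D 0 w = j] = (2^-1)%:E ;
  telegraph_independence : independent_families P
    (preimage_set_system setT (D 0 : Omega -> bool) measurable)
    (sigma_process N) ;
  telegraph_direction : forall w t, 0 <= t ->
    D t w = iter (N t w) negb (D 0 w) ;
  telegraph_position : forall w t, 0 <= t ->
    X t w = x + \int[lebesgue_measure]_(s in `[0, t]) (c * sign_of (D s w))
}.

(* Infimum in the extended reals: [+oo] if the path never leaves [a, b]. *)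
Definition exit_time {R : realType} {Omega : Type} (X : R -> Omega -> R)
    (a b : R) (w : Omega) : \bar R :=
  ereal_inf [set t%:E | t in [set t : R | 0 < t /\ X t w \notin `[a, b]]].

(* The event X(tau) = y; it entails that tau is finite. *)
Definition exits_at {R : realType} {Omega : Type} (X : R -> Omega -> R)
    (a b y : R) : set Omega :=
  [set w | exists2 t : R, exit_time X a b w = t%:E & X t w = y].

Definition exit_right_given {R : realType} {dd : measure_display}
    {Omega : measurableType dd} (P : probability Omega R)
    (D : R -> Omega -> direction) (X : R -> Omega -> R) (a b : R)
    (j : direction) : R :=
  cond_prob P (exits_at X a b b) [set w | D 0 w = j].

Definition exit_right {R : realType} {dd : measure_display}
    {Omega : measurableType dd} (P : probability Omega R)
    (X : R -> Omega -> R) (a b : R) : R :=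
  fine (P (exits_at X a b b)).

(* Main.v *)
Require Import Defs.
From HB Require Import structures.
From mathcomp Require Import all_boot all_order all_algebra.
From mathcomp Require Import all_classical all_reals all_analysis.
From mathcomp Require Import measurable_realfun.
From mathcomp Require Import ring lra.

Set Implicit Arguments.
Unset Strict Implicit.
Unset Printing Implicit Defensive.

Import Order.TTheory GRing.Theory Num.Theory.
Import numFieldNormedType.Exports.

Local Open Scope classical_set_scope.
Local Open Scope ring_scope.

(** The function [h (y, d) = lambda * y + c * 1_(d = d0)] of the position and the
    direction is a martingale along the telegraph process: moving right, [h]
    grows at speed [lambda * c] and drops by [c] at rate [lambda]; moving left,
    it decreases at speed [lambda * c] and jumps up by [c] at rate [lambda].
    The particle leaves [[a, b]] either at [b] moving right, where [h] is
    [lambda * b + c], or at [a] moving left, where [h] is [lambda * a], so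
    optional stopping gives
    [u_j x = (h (x, d_j) - lambda * a) / (c + lambda * (b - a))].

    Optional stopping is carried out in discrete time, where it is an induction
    using only the laws of finitely many Poisson increments.  The directions
    observed on a grid of step [eps] form a Markov chain that reverses with
    probability [q], the probability of an odd number of events
    ([grid_cylinder]).  They drive an Euler walk of step [c * eps], which has
    the exact martingale [walk_harmonic], namely [h] with [lambda / c] replaced
    by [q / (c * eps)].  This gives an upper bound for the probability that the
    walk crosses an upper barrier before a lower one ([walk_crossing_bound]).
    For each outcome, the walk differs from the trajectory by at most
    [2 * c * eps] times the number of events ([walk_error]); hence a trajectory
    that leaves through [b] makes the walk cross slightly lowered barriers, as
    soon as the grid is fine enough ([exits_at_crosses]).  Since [q / eps]
    tends to [lambda], Fatou's lemma yields [P (exit at b, D 0 = d_j) <= u_j x / 2]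
    ([exit_right_upper_bound]).

    The matching lower bound follows by symmetry.  The reflected process
    [- X] is a telegraph process on [[- b, - a]], so the same bound applies to
    the exit through [a]; the two upper bounds add up to 1 / 2, which is also
    the probability of starting in direction [d_j] and leaving at all
    ([exit_almost_surely]).  Therefore both are equalities
    ([exits_at_start_prob]). *)

(** * Trajectories *)

(** The deterministic content of [telegraph_process] for one outcome: every
    statement about a single trajectory is proved from these properties. *)
Record telegraph_path {R : realType} (c x : R) (N : R -> nat)
    (D : R -> direction) (X : R -> R) : Prop := TelegraphPath {
  path_nondecreasing : forall s t, 0 <= s -> s <= t -> (N s <= N t)%N ;
  path_right_continuous : forall t, 0 <= t -> N s @[s --> t^'+] --> N t ;
  path_direction : forall t, 0 <= t -> D t = iter (N t) negb (D 0) ;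
  path_position : forall t, 0 <= t ->
    X t = x + \int[lebesgue_measure]_(s in `[0, t]) (c * sign_of (D s))
}.

Lemma iter_negb n (d : bool) : iter n negb d = odd n (+) d.
Proof. by elim: n => //= n ->; rewrite addNb. Qed.

Section Path.
Context {R : realType}.
Variables (c x : R) (N : R -> nat) (D : R -> direction) (X : R -> R).
Hypothesis c_gt0 : 0 < c.
Hypothesis pathX : telegraph_path c x N D X.

Local Notation mu := (@lebesgue_measure R).
Let v (s : R) : R := c * sign_of (D s).

Lemma sign_of_le1 (d : direction) : `|sign_of d| <= 1 :> R.
Proof. by case: d; rewrite /sign_of ?normrN normr1. Qed.

(** The level sets of a nondecreasing counting function are intervals, so the
    velocity is a countable combination of indicators of intervals. *)
Lemma measurable_velocity (t : R) : measurable_fun `[0, t] v.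
Proof.
have mI k : measurable (`[0, t] `&` [set s | N s = k]).
  apply: is_interval_measurable => r s /= [r0t Nr] [s0t Ns] z /andP[rz zs].
  move: r0t s0t; rewrite !in_itv/= => /andP[r0 rt] /andP[s0 st].
  split; first by rewrite (le_trans r0 rz) (le_trans zs st).
  apply/eqP; rewrite eqn_leq -{1}Ns -Nr.
  by rewrite !(path_nondecreasing pathX)// (le_trans r0 rz).
move=> _ B mB.
rewrite (_ : _ `&` _ =
    \bigcup_(k in [set k | B (c * sign_of (iter k negb (D 0)))])
      (`[0, t] `&` [set s | N s = k])).
  by apply: bigcup_measurable => k _; exact: mI.
apply/seteqP; split=> [s [/= s0t Bs]|s [k /= Bk [s0t Ns]]].
  exists (N s) => //=; rewrite -(path_direction pathX)//.
  by move: s0t; rewrite in_itv/= => /andP[].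
split=> //=; rewrite /v (path_direction pathX) ?Ns//.
by move: s0t; rewrite in_itv/= => /andP[].
Qed.

Lemma integrable_velocity (t : R) : mu.-integrable `[0, t] (EFin \o v).
Proof.
apply: measurable_bounded_integrable => //.
- by rewrite /= lebesgue_measure_itv/=; case: ifPn => // _; rewrite -EFinB ltry.
- exact: measurable_velocity.
- exists c; split; first exact: gtr0_real.
  move=> M cM s _ /=; apply: le_trans (ltW cM).
  by rewrite normrM gtr0_norm// ler_piMr ?sign_of_le1// ltW.
Qed.

Lemma path_at0 : X 0 = x.
Proof.
by rewrite (path_position pathX)// set_itv1 Rintegral_set1 addr0.
Qed.

Lemma displacement s t : 0 <= s -> s <= t ->
  X t - X s = \int[mu]_(r in `]s, t]) v r.
Proof.
move=> s0 st; rewrite !(path_position pathX) ?(le_trans s0 st)//.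
rewrite opprD addrACA subrr add0r Rintegral_itvB//.
exact: integrable_velocity.
Qed.

Lemma integrable_velocity_sub (s t : R) : 0 <= s ->
  mu.-integrable `]s, t] (EFin \o v).
Proof.
move=> s0; apply: (integrableS _ _ _ (integrable_velocity t)) => //.
by apply: subset_itv; rewrite bnd_simp.
Qed.

Let integrable_cst_itv (M s t : R) : mu.-integrable `]s, t] (EFin \o cst M).
Proof.
apply: measurable_bounded_integrable => //; last exact: bounded_cst.
by rewrite /= lebesgue_measure_itv/=; case: ifPn => // _; rewrite -EFinB ltry.
Qed.

Let integral_cst_itv (M s t : R) : s <= t ->
  \int[mu]_(r in `]s, t]) (cst M r) = M * (t - s).
Proof.
move=> st; rewrite Rintegral_cst//= lebesgue_measure_itv/= lte_fin.
move: st; rewrite le_eqVlt => /predU1P[->|->//].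
by rewrite ltxx subrr.
Qed.

Lemma displacement_le (M s t : R) : 0 <= s -> s <= t ->
  (forall r, s < r <= t -> c * sign_of (D r) <= M) -> X t - X s <= M * (t - s).
Proof.
move=> s0 st vM; rewrite displacement// -integral_cst_itv//.
apply: le_Rintegral => [//|||r].
- exact: integrable_velocity_sub.
- exact: integrable_cst_itv.
- by rewrite /= in_itv/=; exact: vM.
Qed.

Lemma displacement_ge (M s t : R) : 0 <= s -> s <= t ->
  (forall r, s < r <= t -> M <= c * sign_of (D r)) -> M * (t - s) <= X t - X s.
Proof.
move=> s0 st vM; rewrite displacement// -integral_cst_itv//.
apply: le_Rintegral => [//|||r].
- exact: integrable_cst_itv.
- exact: integrable_velocity_sub.
- by rewrite /= in_itv/=; exact: vM.
Qed.

Lemma path_lipschitz s t : 0 <= s -> s <= t -> `|X t - X s| <= c * (t - s).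
Proof.
move=> s0 st; rewrite ler_norml; apply/andP; split.
  rewrite -mulNr; apply: displacement_ge => // r _.
  by case: (D r); rewrite /sign_of ?mulrN1 ?mulr1// ge0_cp// ltW.
apply: displacement_le => // r _.
by case: (D r); rewrite /sign_of ?mulrN1 ?mulr1// ge0_cp// ltW.
Qed.

(** Without a Poisson event between [s] and [t] the velocity keeps its value at
    [s]. *)
Lemma path_linear s t : 0 <= s -> s <= t -> N s = N t ->
  X t - X s = c * sign_of (D s) * (t - s).
Proof.
move=> s0 st Nst.
have Dr r : s < r <= t -> D r = D s.
  move=> /andP[/ltW sr rt]; have r0 := le_trans s0 sr.
  rewrite (path_direction pathX r0) (path_direction pathX s0).
  congr iter; apply/eqP.
  by rewrite eqn_leq {1}Nst !(path_nondecreasing pathX).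
apply/eqP; rewrite eq_le displacement_le ?displacement_ge// => r /Dr ->//.
Qed.

(** For a function with values in the discrete space of natural numbers,
    right-continuity means being constant immediately to the right. *)
Lemma path_constant_right t : 0 <= t ->
  exists2 eta, 0 < eta & forall s, t <= s < t + eta -> N s = N t.
Proof.
move=> t0; have : \forall s \near t^'+, N s = N t.
  have /(_ [set N t]) := path_right_continuous pathX t0.
  by apply; rewrite nbhs_principalE.
move=> [e /= e0 He]; exists e => // s /andP[]; rewrite le_eqVlt.
move=> /predU1P[->//|ts] ste; apply: He => //=.
by rewrite distrC gtr0_norm ?subr_gt0// ltrBlDl.
Qed.

End Path.

(** * The walk approximating a trajectory *)

(** The Euler scheme of the trajectory: the walk that keeps, during each time
    step, the direction [s i] observed at the beginning of the step. *)
Definition walk {R : realType} (l y : R) (s : nat -> direction) (k : nat) : R :=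
  y + \sum_(i < k) l * sign_of (s i).

Lemma walk0 {R : realType} (l y : R) s : walk l y s 0 = y.
Proof. by rewrite /walk big_ord0 addr0. Qed.

Lemma walkS {R : realType} (l y : R) s k :
  walk l y s k.+1 = walk l y s k + l * sign_of (s k).
Proof. by rewrite /walk big_ord_recr/= addrA. Qed.

Lemma walk_shift {R : realType} (l y : R) s k :
  walk l y s k.+1 = walk l (y + l * sign_of (s 0)) (fun i => s i.+1) k.
Proof. by rewrite /walk big_ord_recl/= addrA. Qed.

(** Within [m] steps the walk is about to step from its current position over
    [B], having never been below [A].  The crossing is recorded one step in
    advance, while the direction is still known to be [d0]: after the step the
    direction may already have been reversed. *)
Fixpoint crosses {R : realType} (A B l : R) (m : nat) (y : R)
    (s : nat -> direction) : bool :=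
  if m is m'.+1 then
    (A <= y) && ((s 0 == d0) && (B < y + l) ||
                 crosses A B l m' (y + l * sign_of (s 0)) (fun i => s i.+1))
  else false.

Lemma crosses_walk {R : realType} (A B l : R) m k y (s : nat -> direction) :
    (k < m)%N -> (forall i, (i <= k)%N -> A <= walk l y s i) ->
    s k = d0 -> B < walk l y s k + l ->
  crosses A B l m y s.
Proof.
elim: m k y s => [//|m IH] k y s km Aw sk Bw /=.
have -> /= : A <= y by have := Aw 0%N isT; rewrite walk0.
case: k => [|k] in km Aw sk Bw *.
  by move: Bw; rewrite walk0 sk eqxx => ->.
apply/orP; right.
by apply: (IH k) => // [i ik|]; rewrite -walk_shift// Aw.
Qed.

(** The walk is exact on a time step without Poisson event; on any other step
    the error grows by at most twice the length of the step, and the number of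
    such steps is at most the number of events. *)
Lemma walk_error {R : realType} (c x : R) N D X : 0 < c ->
    telegraph_path c x N D X -> forall (h : R) k, 0 <= h ->
  `|X (k%:R * h) - walk (c * h) x (fun i => D (i%:R * h)) k|
    <= 2 * (c * h) * (N (k%:R * h))%:R.
Proof.
move=> c0 pX h k h0; elim: k => [|k IH].
  by rewrite mul0r walk0 (path_at0 pX) subrr normr0 !mulr_ge0// ltW.
have kh0 : 0 <= k%:R * h by rewrite mulr_ge0.
have kS : k.+1%:R * h - k%:R * h = h by rewrite -mulrBl -natrB// subSnn mul1r.
have khS : k%:R * h <= k.+1%:R * h by rewrite -subr_ge0 kS.
rewrite walkS.
set Y := walk _ _ _ _ in IH *.
rewrite (_ : _ - _ = (X (k%:R * h) - Y) + ((X (k.+1%:R * h) - X (k%:R * h))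
   - c * h * sign_of (D (k%:R * h)))); last by ring.
apply: le_trans (ler_normD _ _) _.
have [Neq|Nneq] := eqVneq (N (k%:R * h)) (N (k.+1%:R * h)).
  rewrite (path_linear c0 pX) // kS (mulrAC c h) subrr normr0 addr0.
  by rewrite -Neq.
have {Nneq}NS : (N (k%:R * h)%R < N (k.+1%:R * h)%R)%N.
  by rewrite ltn_neqAle Nneq (path_nondecreasing pX).
have ch0 : 0 <= c * h by rewrite mulr_ge0// ltW.
apply: (@le_trans _ _ (2 * (c * h) * (N (k%:R * h))%:R + (c * h + c * h))).
  rewrite lerD//; apply: le_trans (ler_normB _ _) _; rewrite lerD//.
    by rewrite (le_trans (path_lipschitz c0 pX kh0 khS))// kS.
  by rewrite normrM (ger0_norm ch0) ler_piMr ?sign_of_le1.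
rewrite (_ : _ + (_ + _) = 2 * (c * h) * (N (k%:R * h)).+1%:R); last first.
  by rewrite -natr1; ring.
apply: ler_wpM2l; first by rewrite mulr_ge0.
by rewrite ler_nat.
Qed.

(** * Exit of a trajectory from the interval *)

Section Exit.
Context {R : realType} {Omega : Type}.
Variables (c a b : R) (X : R -> Omega -> R) (w : Omega).
Hypotheses (c_gt0 : 0 < c) (ltab : a < b).
Hypothesis lipX : forall s t, 0 <= s -> s <= t ->
  `|X t w - X s w| <= c * (t - s).
Hypothesis X0ab : a <= X 0 w <= b.

Let lip_bounds s t : 0 <= s -> s <= t ->
  X s w - c * (t - s) <= X t w <= X s w + c * (t - s).
Proof. by move=> s0 st; rewrite -ler_distl lipX. Qed.

(** The interval being closed, the infimum is not attained: at a finite exit time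
    the trajectory is still inside, and it is outside at times arbitrarily close
    on the right. *)
Lemma exit_time_spec (t : R) : exit_time X a b w = t%:E ->
  [/\ 0 <= t, (forall s, 0 <= s -> s <= t -> a <= X s w <= b) &
      forall e, 0 < e -> exists2 s, t < s < t + e & ~~ (a <= X s w <= b)].
Proof.
move=> et.
have lbt s : 0 < s -> ~~ (a <= X s w <= b) -> t <= s.
  move=> s0 Xs; rewrite -lee_fin -et; apply: ereal_inf_lbound.
  by exists s => //=; rewrite in_itv.
have t0 : 0 <= t.
  rewrite -lee_fin -et; apply: le_ereal_inf_tmp => _ [s [s0 _] <-].
  by rewrite lee_fin ltW.
have Xlt s : 0 <= s -> s < t -> a <= X s w <= b.
  rewrite le_eqVlt => /predU1P[<- _ //|s0]; apply: contraTT => /(lbt _ s0).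
  by rewrite leNgt.
have Xt : a <= X t w <= b.
  move: (t0); rewrite le_eqVlt => /predU1P[<-//|tgt0].
  have near e : 0 < e ->
      exists2 s, a <= X s w <= b & X s w - e <= X t w <= X s w + e.
    move=> e0; set s := Num.max 0 (t - e / c).
    have s0 : 0 <= s by rewrite le_max lexx.
    have st : s < t by rewrite gt_max tgt0 ltrBlDr ltrDl divr_gt0.
    have cst : c * (t - s) <= e.
      rewrite mulrC -ler_pdivlMr// lerBlDr -lerBlDl.
      by rewrite le_max lexx orbT.
    exists s; first exact: Xlt.
    have /andP[l1 l2] := lip_bounds s0 (ltW st).
    by rewrite (le_trans _ l1) ?(le_trans l2)// ?lerD2l// lerN2.
  apply/andP; split; apply/ler_addgt0Pr => e /near[s /andP[? ?] /andP[? ?]].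
    lra.
  lra.
split=> // [s s0|e e0].
  by rewrite le_eqVlt => /predU1P[->//|]; exact: Xlt.
apply: contrapT => noexit.
suff : ((t + e)%:E <= exit_time X a b w)%E.
  by rewrite et lee_fin gerDl leNgt e0.
apply: le_ereal_inf_tmp => _ [s [s0 Xs] <-]; rewrite lee_fin leNgt.
apply/negP => ste; apply: noexit; exists s; last by move: Xs; rewrite in_itv/=.
rewrite ste andbT lt_neqAle lbt//.
rewrite andbT; apply: contraNneq Xs => <-; by rewrite in_itv/=.
Qed.

Lemma exit_time_exists s : 0 < s -> ~~ (a <= X s w <= b) ->
  exists2 t, exit_time X a b w = t%:E & t <= s.
Proof.
move=> s0 Xs.
have Es : (exit_time X a b w <= s%:E)%E.
  by apply: ereal_inf_lbound; exists s => //=; rewrite in_itv.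
have E0 : (0%:E <= exit_time X a b w)%E.
  by apply: le_ereal_inf_tmp => _ [r [r0 _] <-]; rewrite lee_fin ltW.
case: (exit_time X a b w) Es E0 => [t ts _|//|//]; exists t => //.
Qed.

(** From an interior point, a trajectory of bounded speed needs a positive time
    to leave. *)
Lemma exit_position t : exit_time X a b w = t%:E -> X t w = a \/ X t w = b.
Proof.
move=> /exit_time_spec[t0 /(_ t t0 (lexx _))/andP[Xa Xb] out].
case: (eqVneq (X t w) a) => [->|Xa']; first by left.
case: (eqVneq (X t w) b) => [->|Xb']; first by right.
have {Xa Xa'}Xa : a < X t w by rewrite lt_neqAle eq_sym Xa'.
have {Xb Xb'}Xb : X t w < b by rewrite lt_neqAle Xb'.
pose e := Num.min (X t w - a) (b - X t w).
have e0 : 0 < e by rewrite lt_min !subr_gt0 Xa.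
have [s /andP[ts ste] /negP[]] := out (e / c) (divr_gt0 e0 c_gt0).
have cst : c * (s - t) <= e.
  by rewrite mulrC -ler_pdivlMr// lerBlDl ltW.
have ea : e <= X t w - a by rewrite ge_min lexx.
have eb : e <= b - X t w by rewrite ge_min lexx orbT.
have /andP[? ?] := lip_bounds t0 (ltW ts).
apply/andP; split; lra.
Qed.

(** Shortly after standing at [b], a trajectory of bounded speed can only be
    outside of the interval by being above [b]. *)
Lemma exits_at_overshoot t : exit_time X a b w = t%:E -> X t w = b ->
  forall e, 0 < e -> exists2 s, t < s < t + e & b < X s w.
Proof.
move=> /exit_time_spec[t0 _ out] Xt e e0.
have f0 : 0 < Num.min e ((b - a) / c).
  by rewrite lt_min e0 divr_gt0// subr_gt0.
have [s /andP[ts]] := out _ f0.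
rewrite -ltrBlDl lt_min ltrBlDl => /andP[se sba] Xs.
exists s; first by rewrite ts.
have /andP[l1 _] := lip_bounds t0 (ltW ts).
move: sba; rewrite ltr_pdivlMr// => sba.
rewrite ltNge; apply: contra Xs => ->; rewrite andbT.
lra.
Qed.

(** Leaving through [b] is being above [b] at some time without having been
    below [a] before; by continuity rational times suffice, which is what makes
    the event measurable. *)
Lemma exits_at_rat :
  exits_at X a b b w <->
  exists q : rat, [/\ 0 < q, b < X (ratr q) w &
    forall r : rat, 0 < r < q -> a <= X (ratr r) w].
Proof.
split=> [[t et Xt]|[q [q0 Xq Xr]]].
  have [t0 Xin _] := exit_time_spec et.
  have ba0 : 0 < (b - a) / c by rewrite divr_gt0// subr_gt0.
  have [s /andP[ts sba] Xs] := exits_at_overshoot et Xt ba0.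
  (* By the speed limit, [X] stays above [b] on this interval before [s]. *)
  have [q] : exists q : rat, ratr q \in `]Num.max t (s - (X s w - b) / c), s[.
    apply: rat_in_itvoo; rewrite gt_max ts ltrBlDr ltrDl divr_gt0//.
    by rewrite subr_gt0.
  rewrite in_itv/= gt_max => /andP[/andP[tq sq] qs].
  have q0 := le_trans t0 (ltW tq).
  have le_aX r : 0 <= r -> r <= s -> a <= X r w.
    move=> r0 rs; have [rt|tr] := leP r t; first by have /andP[] := Xin _ r0 rt.
    have /andP[l1 _] := lip_bounds t0 (ltW tr).
    apply: le_trans l1; rewrite Xt lerBrDl -lerBrDr mulrC -ler_pdivlMr//.
    by rewrite lerBlDl (le_trans rs)// ltW.
  exists q; split => [||r /andP[r0 rq]].
  - by rewrite -(ltr0q R) (le_lt_trans t0).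
  - have /andP[_ l2] := lip_bounds q0 (ltW qs).
    have : c * (s - ratr q) < X s w - b.
      by rewrite mulrC -ltr_pdivlMr// ltrBlDl -ltrBlDr.
    by move: l2; lra.
  - apply: le_aX; first by rewrite ler0q ltW.
    by rewrite (le_trans _ (ltW qs))// ler_rat ltW.
have le_aX s : 0 <= s -> s < ratr q -> a <= X s w.
  move=> s0 sq; apply/ler_addgt0Pr => e e0.
  have [r] : exists r : rat, ratr r \in `]s, Num.min (ratr q) (s + e / c)[.
    by apply: rat_in_itvoo; rewrite lt_min sq ltrDl divr_gt0.
  rewrite in_itv/= lt_min => /and3P[sr rq rse].
  have : a <= X (ratr r) w.
    apply: Xr; rewrite -(ltr0q R) (le_lt_trans s0 sr)/=.
    by rewrite -(ltr_rat R).
  have /andP[_ l2] := lip_bounds s0 (ltW sr).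
  have : c * (ratr r - s) < e by rewrite mulrC -ltr_pdivlMr// ltrBlDl.
  by move: l2; lra.
have q0' : 0 < ratr q :> R by rewrite ltr0q.
have Xqout : ~~ (a <= X (ratr q) w <= b) by rewrite (leNgt _ b) Xq andbF.
have [t et tq] := exit_time_exists q0' Xqout.
exists t => //.
have [t0 Xin out] := exit_time_spec et.
have /andP[aXt Xtb] := Xin t t0 (lexx _).
have {}tq : t < ratr q.
  rewrite lt_neqAle tq andbT; apply/eqP => tq'.
  by move: Xq; rewrite -tq' ltNge Xtb.
apply/eqP; rewrite eq_le Xtb/=; apply/ler_addgt0Pr => e e0.
have f0 : 0 < Num.min (e / c) (ratr q - t) by rewrite lt_min divr_gt0// subr_gt0.
have [s /andP[ts]] := out _ f0.
rewrite -ltrBlDl lt_min ltrD2r => /andP[se sq].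
rewrite le_aX//= ?(le_trans t0 (ltW ts))// -ltNge => Xs.
have /andP[_ l2] := lip_bounds t0 (ltW ts).
have : c * (s - t) < e by rewrite mulrC -ltr_pdivlMr.
by move: l2; lra.
Qed.

End Exit.

Section Crossing.
Context {R : realType} {Omega : Type}.
Variables (c a b x : R) (N : R -> Omega -> nat) (D : R -> Omega -> direction).
Variables (X : R -> Omega -> R) (w : Omega).
Hypotheses (c_gt0 : 0 < c) (ltab : a < b) (xab : a <= x <= b).
Hypothesis pathX : telegraph_path c x (N ^~ w) (D ^~ w) (X ^~ w).

(** A trajectory moving left at [b] would stay below [b] for a while, so it
    would not leave the interval there. *)
Lemma exits_at_direction t : exit_time X a b w = t%:E -> X t w = b ->
  D t w = d0.
Proof.
move=> et Xt.
have lipX s r : 0 <= s -> s <= r -> `|X r w - X s w| <= c * (r - s).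
  exact: (path_lipschitz c_gt0 pathX).
have X0ab : a <= X 0 w <= b by rewrite (path_at0 pathX).
have [t0 _ _] := exit_time_spec c_gt0 lipX X0ab et.
have [eta eta0 Nt] := path_constant_right pathX t0.
have [s /andP[ts se]] := exits_at_overshoot c_gt0 ltab lipX X0ab et Xt eta0.
have := path_linear c_gt0 pathX t0 (ltW ts) (esym (Nt _ _)).
rewrite (ltW ts) se => /(_ isT) /=; rewrite Xt.
case: (D t w) => //; rewrite /sign_of mulrN1 => Xs.
have : 0 < c * (s - t) by rewrite mulr_gt0// subr_gt0.
by move: Xs; lra.
Qed.

(** With time step [n.+1 ^- 2] the walk stays within [C * n.+1 ^- 2] of the
    trajectory, where [C] depends on the number of events, hence eventually
    within the tolerance [n.+1^-1], which does not depend on the outcome.  The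
    witness is the first grid time after the exit time [t]: no reversal has
    occurred in between, so the walk is there at least at [b - n.+1^-1] and
    moves right.  The number of steps [n.+1 ^ 3] covers the times up to
    [n.+1], eventually beyond [t]. *)
Lemma exits_at_crosses : exits_at X a b b w ->
  \forall n \near \oo,
    crosses (a - n.+1%:R^-1) (b - n.+1%:R^-1) (c * n.+1%:R ^- 2) (n.+1 ^ 3).+1 x
      (fun i => D (i%:R * n.+1%:R ^- 2) w).
Proof.
move=> [t et Xt].
have lipX s r : 0 <= s -> s <= r -> `|X r w - X s w| <= c * (r - s).
  exact: (path_lipschitz c_gt0 pathX).
have X0ab : a <= X 0 w <= b by rewrite (path_at0 pathX).
have [t0 Xin _] := exit_time_spec c_gt0 lipX X0ab et.
have Dt := exits_at_direction et Xt.
have [eta eta0 Nt] := path_constant_right pathX t0.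
have Xright s : t <= s < t + eta -> b <= X s w.
  move=> /[dup] /andP[ts _] /Nt /esym Nst.
  have := path_linear c_gt0 pathX t0 ts Nst.
  rewrite Dt /= mulr1 Xt => Xs.
  have : 0 <= c * (s - t) by rewrite mulr_ge0 ?subr_ge0// ltW.
  by move: Xs; lra.
near=> n.
set m : R := n.+1%:R.
have m0 : 0 < m by rewrite ltr0n.
have m1 : 1 <= m by rewrite ler1n.
set h := m ^- 2.
have h0 : 0 < h by rewrite invr_gt0 exprn_gt0.
have hm : h <= m^-1.
  by rewrite /h exprS expr1 invfM ler_piMr ?invr_ge0 ?invf_le1// ltW.
have heta : h < eta.
  apply: le_lt_trans hm _; rewrite invf_plt ?posrE//.
  apply: (@le_lt_trans _ _ n%:R); last by rewrite ltr_nat.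
  by near: n; exact: nbhs_infty_ger.
have tm : t + 1 <= m.
  apply: (@le_trans _ _ n%:R); last by rewrite ler_nat.
  by near: n; exact: nbhs_infty_ger.
have Nm : 2 * c * (N t w)%:R <= m.
  apply: (@le_trans _ _ n%:R); last by rewrite ler_nat.
  by near: n; exact: nbhs_infty_ger.
pose k := (Num.truncn (t / h)).+1.
have /andP[k1 k2] : k.-1%:R <= t / h < k%:R.
  by rewrite /k truncn_itv// divr_ge0// ltW.
have tk : t < k%:R * h by rewrite -ltr_pdivrMr.
have kt : k%:R * h <= t + h.
  by rewrite /k -natr1 mulrDl mul1r lerD2r -ler_pdivlMr.
have kin : t <= k%:R * h < t + eta.
  by rewrite (ltW tk) (le_lt_trans kt)// ltrD2l.
have err i : (i <= k)%N -> X (i%:R * h) w - m^-1 <=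
    walk (c * h) x (fun i => D (i%:R * h) w) i.
  move=> ik; have := walk_error c_gt0 pathX i (ltW h0).
  have Ni : (N (i%:R * h)%R w <= N t w)%N.
    rewrite -(Nt _ kin); apply: (path_nondecreasing pathX).
      by rewrite mulr_ge0// ltW.
    by rewrite ler_pM2r// ler_nat.
  have : 2 * (c * h) * (N (i%:R * h)%R w)%:R <= m^-1.
    apply: (@le_trans _ _ (2 * (c * h) * (N t w)%:R)).
      by rewrite ler_wpM2l ?ler_nat// !mulr_ge0 ?ltW.
    rewrite (_ : 2 * _ * _ = 2 * c * (N t w)%:R * h); last by ring.
    apply: le_trans (ler_wpM2r (ltW h0) Nm) _.
    by rewrite /h exprS expr1 invfM mulrA mulfV ?gt_eqF// mul1r.
  rewrite ler_norml => e1 /andP[_ e2].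
  by rewrite lerBlDl -lerBlDr (le_trans e2).
apply: (@crosses_walk _ _ _ _ _ k).
- rewrite ltnS -(ler_nat R) /k -natr1 natrX.
  apply: (@le_trans _ _ (t * m ^+ 2 + 1)).
    by rewrite lerD2r -[m ^+ 2]invrK.
  rewrite (exprS m 2); apply: le_trans (ler_wpM2r (exprn_ge0 2 (ltW m0)) tm).
  by rewrite mulrDl mul1r lerD2l exprn_ege1.
- move=> i ik; apply: le_trans (err i ik); rewrite lerD2r.
  have ih0 : 0 <= i%:R * h by rewrite mulr_ge0// ltW.
  have [it|ti] := leP (i%:R * h) t; first by have /andP[] := Xin _ ih0 it.
  apply: le_trans (ltW ltab) _; apply: Xright.
  rewrite (ltW ti)/= (le_lt_trans _ (andP kin).2)//.
  by rewrite ler_pM2r// ler_nat.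
- rewrite -Dt (path_direction pathX) ?mulr_ge0 ?ltW//.
  by rewrite (path_direction pathX t0) -(Nt _ kin).
- apply: (@le_lt_trans _ _ (walk (c * h) x (fun i => D (i%:R * h) w) k)).
    by apply: le_trans (err k (leqnn _)); rewrite lerD2r Xright.
  by rewrite ltrDl mulr_gt0.
Unshelve. all: by end_near. Qed.

End Crossing.

(** * The crossing probability of a random walk with persistent direction *)

Section WalkBound.
Context {R : realType} {dd : measure_display} {Omega : measurableType dd}.
Variables (P : probability Omega R).

Let measurable_const (Q : bool) : measurable [set _ : Omega | Q].
Proof.
case: Q; first by rewrite (_ : [set _ | _] = setT)//; apply/seteqP; split.
by rewrite (_ : [set _ | _] = set0)//; apply/seteqP; split.
Qed.

Lemma measurable_preimage_eq {T : measurableType dd} (f : T -> bool) d :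
  measurable_fun setT f -> measurable [set w | f w = d].
Proof.
by move=> mf; rewrite -[X in measurable X]setTI; exact: (mf measurableT [set d]).
Qed.

Lemma measurable_crosses (A B l : R) m y (xi : nat -> Omega -> direction) :
    (forall k, measurable_fun setT (xi k : Omega -> bool)) ->
  measurable [set w | crosses A B l m y (xi ^~ w)].
Proof.
elim: m y xi => [|m IH] y xi mxi; first exact: (measurable_const false).
have mx d : measurable [set w | xi 0%N w = d].
  exact: (measurable_preimage_eq d (mxi 0%N)).
rewrite (_ : [set _ | _] =
  [set w | A <= y] `&` (([set w | xi 0%N w = d0] `&` [set _ | B < y + l]) `|`
  \bigcup_d ([set w | xi 0%N w = d] `&`
     [set w | crosses A B l m (y + l * sign_of d) ((fun i => xi i.+1) ^~ w)]))).
  apply: measurableI; first exact: measurable_const.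
  apply: measurableU; first exact: measurableI.
  apply: fin_bigcup_measurable => [|d _]; first exact: (@finite_finset bool).
  by apply: measurableI => //; apply: IH.
apply/seteqP; split=> w /=.
  move=> /andP[? /orP[/andP[/eqP ? ?]|?]]; split => //; first by left.
  by right; exists (xi 0%N w).
by move=> [-> [[-> ->]//|[d _ [<- ->]]]]; rewrite orbT.
Qed.

Variables (xi : nat -> Omega -> direction) (q : R).
Hypothesis measurable_xi : forall k, measurable_fun setT (xi k : Omega -> bool).

Definition cylinder (k : nat) (pre : nat -> direction) : set Omega :=
  [set w | forall i, (i <= k)%N -> xi i w = pre i].

Hypothesis cylinder_law : forall k pre,
  P (cylinder k.+1 pre) =
  (P (cylinder k pre) * (if pre k.+1 == pre k then 1 - q else q)%:E)%E.

Lemma measurable_cylinder k pre : measurable (cylinder k pre).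
Proof.
rewrite (_ : cylinder _ _ =
    \bigcap_(i in [set i | (i <= k)%N]) [set w | xi i w = pre i])//.
apply: bigcap_measurable => [|i _]; first by exists 0%N.
exact: (measurable_preimage_eq (pre i) (measurable_xi i)).
Qed.

Variables (A B l g : R).
Hypotheses (ltAB : A < B) (l_ge0 : 0 <= l) (g_ge0 : 0 <= g) (gl : g * l = q).

(** Up to an affine change, [g * y + 1_(d = d0)]: an upward step gains [g * l = q]
    and then loses 1 with probability [q].  It is normalized to be nonnegative
    from [A - l] on, the lowest position where the walk can first be below [A],
    and at least 1 when the walk is about to step over [B].  For [l = 0] and
    [g = lambda / c] it is the exit probability of the telegraph process. *)
Definition walk_harmonic (y : R) (d : direction) : R :=
  (g * (y - A + l) + (d == d0)%:R) / (g * (B - A) + 1).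

Let den_gt0 : 0 < g * (B - A) + 1.
Proof. by rewrite ltr_wpDl// mulr_ge0// subr_ge0 ltW. Qed.

Lemma walk_harmonic_mean y d :
  (1 - q) * walk_harmonic (y + l * sign_of d) d +
    q * walk_harmonic (y + l * sign_of d) (~~ d) = walk_harmonic y d.
Proof.
rewrite /walk_harmonic 2!mulrA -mulrDl; congr (_ / _); rewrite -gl.
by case: d; rewrite /sign_of /d0 /=; ring.
Qed.

(** Optional stopping for the martingale [walk_harmonic], which is nonnegative up
    to the first passage below [A], carried out by recursion on the number of
    steps.  As only an upper bound is claimed,
    the paths that have not crossed yet can be discarded. *)
Lemma walk_crossing_bound m k pre y : A - l <= y ->
  (P (cylinder k pre `&`
      [set w | crosses A B l m y (fun i => xi (k + i)%N w)])
   <= P (cylinder k pre) * (walk_harmonic y (pre k))%:E)%E.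
Proof.
elim: m k pre y => [|m IH] k pre y Aly.
all: have yAl : 0 <= y - A + l by lra.
all: have h0 : 0 <= walk_harmonic y (pre k) := divr_ge0
  (addr_ge0 (mulr_ge0 g_ge0 yAl) (ler0n _ _)) (ltW den_gt0).
  rewrite (_ : _ `&` _ = set0) ?measure0 ?mule_ge0 ?lee_fin//.
  by apply/seteqP; split=> w // [].
have [yA|Ay] := ltP y A.
  rewrite (_ : _ `&` _ = set0) ?measure0 ?mule_ge0 ?lee_fin//.
  by apply/seteqP; split=> w //=; rewrite leNgt yA => -[].
have mcr k' y' : measurable (cylinder k' pre `&`
    [set w | crosses A B l m.+1 y' (fun i => xi (k' + i)%N w)]).
  by apply: measurableI; [exact: measurable_cylinder|exact: measurable_crosses].
have [/andP[pk0 By]|nstop] := boolP ((pre k == d0) && (B < y + l)).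
  have h1 : 1 <= walk_harmonic y (pre k).
    by rewrite ler_pdivlMr// mul1r pk0 lerD2r ler_wpM2l//; lra.
  apply: (@le_trans _ _ (P (cylinder k pre))); last first.
    by rewrite -[leLHS]mule1 lee_wpmul2l// lee_fin.
  apply: le_measure; rewrite ?inE; [exact: mcr| |exact: subIsetl].
  exact: measurable_cylinder.
(* Otherwise the walk makes a step and the next direction is revealed. *)
pose ext e i := if i == k.+1 then e else pre i.
have ext_cyl e : cylinder k (ext e) = cylinder k pre.
  apply/seteqP; split=> w cw i ik; have := cw i ik;
    by rewrite /ext ltn_eqF.
have extk e : ext e k = pre k by rewrite /ext ltn_eqF.
have extS e : ext e k.+1 = e by rewrite /ext eqxx.
pose y' := y + l * sign_of (pre k).
have Aly' : A - l <= y'.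
  rewrite /y'; case: (pre k); rewrite /sign_of ?mulrN1 ?mulr1; first lra.
  by move: l_ge0; lra.
pose F e := cylinder k.+1 (ext e) `&`
  [set w | crosses A B l m y' (fun i => xi (k.+1 + i)%N w)].
have mF e : measurable (F e).
  by apply: measurableI; [exact: measurable_cylinder|exact: measurable_crosses].
have PF e : (P (F e) <= P (cylinder k pre) *
    ((if e == pre k then 1 - q else q) * walk_harmonic y' e)%:E)%E.
  have := IH k.+1 (ext e) y' Aly'.
  by rewrite cylinder_law ext_cyl extS extk -muleA -EFinM.
apply: (@le_trans _ _ (P (F (pre k) `|` F (~~ pre k)))).
  apply: le_measure; rewrite ?inE.
  - exact: mcr.
  - exact: measurableU.
  - move=> w [cw] /=; rewrite addn0 (cw k)// Ay (negPf nstop)/= => cr.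
    suff : F (xi k.+1 w) w.
      by case: (xi k.+1 w) (pre k) => -[]; [left|right|right|left].
    split=> [i|/=].
      rewrite leq_eqVlt => /predU1P[->|ik]; first by rewrite extS.
      by rewrite /ext ltn_eqF// cw.
    by move: cr; congr (is_true (crosses _ _ _ _ _ _)); apply/funext => i;
       rewrite addnS addSn.
apply: (le_trans (measureU2 _ _ _)) => //.
apply: (le_trans (leeD (PF _) (PF _))).
rewrite eqxx (negPf (_ : ~~ pre k != pre k)); last by case: (pre k).
have -> : P (cylinder k pre) = (fine (P (cylinder k pre)))%:E.
  by rewrite fineK// fin_num_measure//; exact: measurable_cylinder.
by rewrite -!EFinM -EFinD -mulrDr walk_harmonic_mean.
Qed.

End WalkBound.

(** * Parity of Poisson increments *)

Lemma measurable_nat2 d (T : measurableType d) (f g : T -> nat)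
    (Q : nat -> nat -> Prop) :
    measurable_fun setT f -> measurable_fun setT g ->
  measurable [set w | Q (f w) (g w)].
Proof.
move=> mf mg.
rewrite (_ : [set _ | _] = \bigcup_i \bigcup_(j in [set j | Q i j])
    ((setT `&` f @^-1` [set i]) `&` (setT `&` g @^-1` [set j]))).
  apply: bigcup_measurable => i _; apply: bigcup_measurable => j _.
  by apply: measurableI; [exact: mf|exact: mg].
apply/seteqP; split=> w /=.
  by move=> Qw; exists (f w) => //; exists (g w).
by move=> [i _ [j /= Qij [[_ ->] [_ ->]]]].
Qed.

Section Poisson.
Context {R : realType} {dd : measure_display} {Omega : measurableType dd}.
Variables (P : probability Omega R) (lambda : R) (N : R -> Omega -> nat).
Hypothesis lambda_gt0 : 0 < lambda.
Hypothesis poissonN : poisson_process P lambda N.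

Lemma measurable_increment s t A : 0 <= s -> 0 <= t ->
  measurable [set w | A (N t w - N s w)%N].
Proof.
move=> s0 t0; apply: (@measurable_nat2 _ _ (N t) (N s) (fun i j => A (i - j)%N)).
  exact: (poisson_measurable poissonN).
exact: (poisson_measurable poissonN).
Qed.

(** The probability that a Poisson variable of mean [r] is odd, which is that of
    opposite directions at the ends of a time step with mean number of events
    [r]. *)
Definition odd_prob (r : R) : R :=
  fine (\sum_(k <oo | k \in [set k | odd k]) (poisson_pmf r k)%:E).

Lemma odd_prob_ge0 r : 0 <= odd_prob r.
Proof.
by apply/fine_ge0/nneseries_ge0 => k _ _; rewrite lee_fin poisson_pmf_ge0.
Qed.

Lemma odd_increment s t : 0 <= s -> s < t ->
  P [set w | odd (N t w - N s w)] = (odd_prob (lambda * (t - s)))%:E.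
Proof.
move=> s0 st; have t0 := le_trans s0 (ltW st).
have mk k : measurable [set w | (N t w - N s w)%N = k].
  exact: (measurable_increment (fun n => n = k) s0 t0).
have E : P [set w | odd (N t w - N s w)] =
    (\sum_(k <oo | k \in [set k | odd k])
       (poisson_pmf (lambda * (t - s)) k)%:E)%E.
  rewrite (_ : [set w | _] =
      \bigcup_(k in [set k | odd k]) [set w | (N t w - N s w)%N = k]).
    rewrite measure_bigcup//.
      by apply: eq_eseriesr => k _; exact: (poisson_increment_law poissonN).
    by apply/trivIsetP => i j _ _ ij; apply/seteqP; split=> w //= -[Ni Nj];
       move: ij; rewrite -Ni -Nj eqxx.
  apply/seteqP; split=> w /=; first by move=> ow; exists (N t w - N s w)%N.
  by move=> [k /= ok ->].
rewrite /odd_prob -E fineK// fin_num_measure//.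
exact: (measurable_increment (fun n => odd n) s0 t0).
Qed.

Lemma no_increment s t : 0 <= s -> s < t ->
  P [set w | (N t w - N s w)%N = 0%N] = (expR (- (lambda * (t - s))))%:E.
Proof.
move=> s0 st; rewrite (poisson_increment_law poissonN)// /poisson_pmf.
by rewrite mulr_gt0 ?subr_gt0// expr0 fact0 invr1 !mul1r.
Qed.

(** One event makes the count odd and an odd count requires an event, so
    [odd_prob r] is between [r * expR (- r)] and [1 - expR (- r)]. *)
Lemma odd_prob_bounds r : 0 < r -> r * (1 - r) <= odd_prob r <= r.
Proof.
move=> r0.
have t0 : 0 < r / lambda by rewrite divr_gt0.
have rE : r = lambda * (r / lambda - 0) by rewrite subr0 mulrC divfK// gt_eqF.
have mi A := measurable_increment A (lexx 0) (ltW t0).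
rewrite rE -!lee_fin -(odd_increment _ t0)// -rE; apply/andP; split.
  apply: (@le_trans _ _ (P [set w | (N (r / lambda)%R w - N 0 w)%N = 1%N])).
    rewrite (poisson_increment_law poissonN)// -rE /poisson_pmf r0.
    rewrite lee_fin expr1 invr1 mulr1.
    by apply: ler_wpM2l; [exact: ltW|exact: expR_ge1Dx].
  apply: le_measure; rewrite ?inE; first exact: (mi (fun n => n = 1%N)).
    exact: (mi (fun n => odd n)).
  by move=> w /= ->.
apply: (@le_trans _ _ (P (~` [set w | (N (r / lambda)%R w - N 0 w)%N = 0%N]))).
  apply: le_measure; rewrite ?inE; first exact: (mi (fun n => odd n)).
    by apply: measurableC; exact: (mi (fun n => n = 0%N)).
  by move=> w /= + N0; rewrite N0.
rewrite probability_setC; last exact: (mi (fun n => n = 0%N)).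
rewrite no_increment// -rE -EFinB lee_fin lerBlDl -lerBlDr.
exact: expR_ge1Dx.
Qed.

End Poisson.

(** * The directions of the telegraph process on a time grid *)

Section Telegraph.
Context {R : realType} {dd : measure_display} {Omega : measurableType dd}.
Variables (P : probability Omega R) (lambda c x : R).
Variables (N : R -> Omega -> nat) (D : R -> Omega -> direction).
Variable X : R -> Omega -> R.
Hypotheses (lambda_gt0 : 0 < lambda) (c_gt0 : 0 < c).
Hypothesis telegraphX : telegraph_process P lambda c x N D X.

Let poissonN : poisson_process P lambda N := telegraph_poisson telegraphX.

Lemma telegraph_pathwise w : telegraph_path c x (N ^~ w) (D ^~ w) (X ^~ w).
Proof.
split=> [s t s0 st|t t0|t t0|t t0].
- exact: (poisson_nondecreasing poissonN).
- exact: (poisson_right_continuous poissonN).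
- exact: (telegraph_direction telegraphX).
- exact: (telegraph_position telegraphX).
Qed.

Lemma telegraph_directionE w t : 0 <= t -> D t w = odd (N t w) (+) D 0 w.
Proof. by move=> t0; rewrite (telegraph_direction telegraphX)// iter_negb. Qed.

(** The directions seen on a time grid determine, and are determined by, the
    initial direction and the parities of the increments. *)
Lemma direction_change w s t : 0 <= s -> s <= t ->
  odd (N t w - N s w) = D s w (+) D t w.
Proof.
move=> s0 st.
rewrite (telegraph_directionE w s0) (telegraph_directionE w (le_trans s0 st)).
rewrite oddB ?(poisson_nondecreasing poissonN)//.
by case: (odd _) (odd _) (D 0 w) => -[] [].
Qed.

Lemma measurable_direction t : 0 <= t -> measurable_fun setT (D t : Omega -> bool).
Proof.
move=> t0; rewrite (_ : D t = fun w => odd (N t w) (+) D 0 w); last first.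
  by apply/funext => w; rewrite telegraph_directionE.
move=> _ B _; rewrite setTI.
rewrite (_ : _ @^-1` _ = \bigcup_(k in setT) \bigcup_(d in [set d : bool | B (odd k (+) d)])
   ((setT `&` N t @^-1` [set k]) `&` [set w | D 0 w = d])).
  apply: bigcup_measurable => k _; apply: fin_bigcup_measurable => [|d _].
    exact: (@finite_finset bool).
  apply: measurableI; first exact: (poisson_measurable poissonN).
  exact: (measurable_preimage_eq d (telegraph_start_measurable telegraphX)).
apply/seteqP; split=> w /=.
  by move=> Bw; exists (N t w) => //; exists (D 0 w).
by move=> [k _ [d Bd [[_ ->] ->]]].
Qed.

(** An event about finitely many increments belongs to the sigma-algebra of
    [N], so independence of the initial direction and independence of the
    increments combine into one product formula. *)
Lemma start_independent_increments (j : direction) n (t : nat -> R)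
    (A : nat -> set nat) : 0 <= t 0%N -> nondecreasing_seq t ->
  P ([set w | D 0 w = j] `&`
     [set w | forall i, (i < n)%N -> A i (N (t i.+1) w - N (t i) w)%N]) =
  (2^-1%:E *
   \prod_(i < n) P [set w | A i (N (t i.+1) w - N (t i) w)%N])%E.
Proof.
move=> t0 ndt.
have tge0 i : 0 <= t i by apply: le_trans t0 _; exact: ndt.
rewrite (_ : [set w | forall i, (i < n)%N ->
      A i (N (t i.+1) w - N (t i) w)%N] = \bigcap_(i : 'I_n)
    ((fun w => (N (t i.+1) w - N (t i) w)%N) @^-1` A i)); last first.
  apply/seteqP; split=> w /= Aw.
    by move=> i _; exact: Aw.
  by move=> i ik; exact: (Aw (Ordinal ik) I).
rewrite (telegraph_independence telegraphX).
- congr (_ * _)%E; first exact: (telegraph_start_law telegraphX).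
  exact: (poisson_independent_increments poissonN t0 ndt
           (A := fun i : 'I_n => A i)).
- by exists [set j]; rewrite // setTI.
- pose G := \bigcup_(t in [set t : R | 0 <= t])
              preimage_set_system setT (N t) measurable.
  have mN s : 0 <= s ->
      measurable_fun setT (N s : g_sigma_algebraType G -> nat).
    move=> s0 _ B mB; apply: sub_sigma_algebra.
    by exists s => //; exists B.
  apply: (@fin_bigcap_measurable _ (g_sigma_algebraType G)) => [|i _].
    exact: finite_finset.
  apply: (@measurable_nat2 _ (g_sigma_algebraType G)
    (N (t i.+1)) (N (t i)) (fun a b => A i (a - b)%N)); exact: mN.
Qed.

Section Grid.
Variable h : R.
Hypothesis h_gt0 : 0 < h.

Let xi (k : nat) : Omega -> direction := D (k%:R * h).

Let q := odd_prob (lambda * h).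

Let grid_ge0 k : 0 <= k%:R * h. Proof. by rewrite mulr_ge0// ltW. Qed.

Let grid_lt k : k%:R * h < k.+1%:R * h.
Proof. by rewrite ltr_pM2r// ltr_nat. Qed.

Let gridB k : k.+1%:R * h - k%:R * h = h.
Proof. by rewrite -mulrBl -natrB// subSnn mul1r. Qed.

(** On a regular grid the direction is a Markov chain reversed with probability
    [q] at each step. *)
Lemma grid_cylinder k pre : P (cylinder xi k pre) =
  (2^-1 * \prod_(i < k) (if pre i.+1 == pre i then 1 - q else q))%:E.
Proof.
pose A i : set nat := [set n | odd n = pre i (+) pre i.+1].
rewrite (_ : cylinder _ _ _ = [set w | D 0 w = pre 0%N] `&`
  [set w | forall i, (i < k)%N ->
     A i (N (i.+1%:R * h)%R w - N (i%:R * h)%R w)%N]).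
  rewrite (@start_independent_increments _ _ (fun i => i%:R * h)) ?mul0r//;
    last by move=> i j ij; rewrite ler_pM2r// ler_nat.
  rewrite EFinM -prodEFin; congr (_ * _)%E; apply: eq_bigr => i _.
  have odd_i := odd_increment poissonN (grid_ge0 i) (grid_lt i).
  rewrite gridB -/q in odd_i.
  have [e|ne] := eqVneq (pre i.+1) (pre i).
    rewrite /A e addbb EFinB -odd_i -probability_setC.
      congr (P _); apply/seteqP; split=> w /=; first by move=> ->.
      by move/negP/negbTE.
    exact: (measurable_increment poissonN (fun n => odd n)).
  rewrite -odd_i; congr (P _); apply/seteqP; split=> w; rewrite /A /=.
    by move: ne; case: (pre i) (pre i.+1) => -[].
  by move: ne; case: (pre i) (pre i.+1) => -[].
apply/seteqP; split=> w.
  move=> cw; split=> [|i ik]; first by rewrite -(cw 0%N)// /xi mul0r.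
  rewrite /A /= direction_change ?grid_ge0 ?ltW//.
  by rewrite -(cw i (ltnW ik)) -(cw i.+1 ik).
move=> [w0 Aw]; elim=> [_|i IH ik]; first by rewrite /xi mul0r.
have := Aw i ik; rewrite /A /= direction_change ?grid_ge0 ?ltW//.
by rewrite -IH ?(ltnW ik)// => /addbI.
Qed.

Lemma measurable_grid k : measurable_fun setT (xi k : Omega -> bool).
Proof. exact: measurable_direction. Qed.

Lemma grid_crossing_bound (A B : R) m y j : A < B -> A <= y ->
  (P ([set w | D 0 w = j] `&` [set w | crosses A B (c * h) m y (xi ^~ w)])
   <= (2^-1 * walk_harmonic A B (c * h) (q / (c * h)) y j)%:E)%E.
Proof.
move=> AB Ay.
have ch0 : 0 < c * h by rewrite mulr_gt0.
have law k pre : P (cylinder xi k.+1 pre) =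
    (P (cylinder xi k pre) * (if pre k.+1 == pre k then 1 - q else q)%:E)%E.
  by rewrite !grid_cylinder big_ord_recr/= -EFinM mulrA.
have := @walk_crossing_bound _ _ _ P xi q measurable_grid law A B (c * h)
  (q / (c * h)) AB (ltW ch0) _ _ m 0%N (fun=> j) y _.
rewrite grid_cylinder big_ord0 mulr1 -EFinM => bound.
have -> : [set w | D 0 w = j] = cylinder xi 0 (fun=> j).
  apply/seteqP; split=> w /=; rewrite /xi.
    by move=> w0 i; rewrite leqn0 => /eqP ->; rewrite mul0r.
  by move=> /(_ 0%N isT); rewrite mul0r.
apply: bound.
- by rewrite divr_ge0 ?odd_prob_ge0// ltW.
- by rewrite divfK// gt_eqF.
- by rewrite lerBlDr ler_wpDr// ltW.
Qed.

End Grid.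
End Telegraph.

(** * Upper bound for the exit through b, and almost sure exit *)

(** A form of Fatou's lemma for events, applied to [A] intersected with the
    tails of the intersections of the [H n]. *)
Lemma measure_eventually_le {R : realType} {dd : measure_display}
    {Omega : measurableType dd} (P : probability Omega R) (A : set Omega)
    (H : nat -> set Omega) (u : nat -> R) (l : R) :
    measurable A -> (forall n, measurable (H n)) ->
    (forall w, A w -> \forall n \near \oo, H n w) ->
    (forall n, (P (H n) <= (u n)%:E)%E) -> u n @[n --> \oo] --> l ->
  (P A <= l%:E)%E.
Proof.
move=> mA mH AH PH ul.
pose F m := A `&` \bigcap_(n in [set n | (m <= n)%N]) H n.
have mF m : measurable (F m).
  apply: measurableI => //; apply: bigcap_measurable => //.
  by exists m => /=.
have UF : \bigcup_m F m = A.
  apply/seteqP; split=> [w [m _ []//]|w Aw].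
  by have [m _ Hm] := AH w Aw; exists m.
have ndF : nondecreasing_seq F.
  move=> m n mn; apply/subsetPset => w [Aw Hw]; split=> // k /= nk.
  by apply: Hw => /=; exact: leq_trans nk.
have := @nondecreasing_cvg_mu _ _ _ P F mF; rewrite UF => /(_ mA ndF) PF.
have ul' : (u n)%:E @[n --> \oo] --> l%:E.
  by apply: cvg_EFin => //; exact: nearW.
apply: (lee_cvg_to PF ul').
apply: nearW => n /=; apply: le_trans (PH n).
by apply: le_measure; rewrite ?inE// => w [_]; apply => /=.
Qed.

Section ExitProbability.
Context {R : realType} {dd : measure_display} {Omega : measurableType dd}.
Variables (P : probability Omega R) (lambda c a b x : R).
Variables (N : R -> Omega -> nat) (D : R -> Omega -> direction).
Variable X : R -> Omega -> R.
Hypotheses (lambda_gt0 : 0 < lambda) (c_gt0 : 0 < c) (ltab : a < b).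
Hypothesis xab : a <= x <= b.
Hypothesis telegraphX : telegraph_process P lambda c x N D X.

Let pathX := telegraph_pathwise telegraphX.

Let lipX w s t : 0 <= s -> s <= t -> `|X t w - X s w| <= c * (t - s).
Proof. exact: (path_lipschitz c_gt0 (pathX w)). Qed.

Let X0ab w : a <= X 0 w <= b.
Proof. by rewrite (path_at0 (pathX w)). Qed.

(** The position is the limit of the walks with time step [t / n.+1], which
    depend on finitely many directions. *)
Lemma measurable_position t : 0 <= t -> measurable_fun setT (X t).
Proof.
move=> t0.
pose h n : R := t / n.+1%:R.
have h0 n : 0 <= h n by rewrite divr_ge0.
have hn n : n.+1%:R * h n = t by rewrite mulrC divfK.
apply: (@measurable_fun_cvg _ _ _ _
    (fun n w => walk (c * h n) x (fun i => D (i%:R * h n) w) n.+1)).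
  move=> n; apply: measurable_funD => //; apply: measurable_sum => i.
  apply: measurable_funM => //.
  have mD : measurable_fun setT (D (i%:R * h n) : Omega -> bool).
    by apply: (measurable_direction telegraphX); rewrite mulr_ge0.
  rewrite (_ : (fun _ => _) = (fun d : bool => sign_of d) \o D (i%:R * h n))//.
  by apply: measurableT_comp.
move=> w _; apply/cvgrPdist_le => e e0; near=> n.
have := walk_error c_gt0 (pathX w) n.+1 (h0 n); rewrite hn => err.
apply: (le_trans err).
rewrite (_ : 2 * _ * _ = 2 * c * (N t w)%:R * t / n.+1%:R); last first.
  by rewrite /h; ring.
rewrite ler_pdivrMr// -ler_pdivrMl//.
apply: (@le_trans _ _ n%:R); last by rewrite ler_nat.
by near: n; exact: nbhs_infty_ger.
Unshelve. all: by end_near. Qed.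

Lemma measurable_exits_at : measurable (exits_at X a b b).
Proof.
have mlt r : 0 <= r -> measurable [set w | X r w < a].
  move=> r0; rewrite -[X in measurable X]setTI.
  rewrite (_ : [set w | _] = X r @^-1` `]-oo, a[); last first.
    by apply/seteqP; split=> w /=; rewrite in_itv.
  exact: measurable_position.
have mgt r : 0 <= r -> measurable [set w | b < X r w].
  move=> r0; rewrite -[X in measurable X]setTI.
  rewrite (_ : [set w | _] = X r @^-1` `]b, +oo[); last first.
    by apply/seteqP; split=> w /=; rewrite in_itv/= andbT.
  exact: measurable_position.
pose below (q r : rat) : set Omega :=
  if 0 < r < q then [set w | X (ratr r) w < a] else set0.
have mbelow q r : measurable (below q r).
  rewrite /below; case: ifP => // /andP[r0 _].
  by apply: mlt; rewrite ler0q ltW.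
pose over (q : rat) : set Omega :=
  if 0 < q then [set w | b < X (ratr q) w] `\` \bigcup_r below q r else set0.
rewrite (_ : exits_at _ _ _ _ = \bigcup_q over q).
  apply: bigcupT_measurable_rat => q; rewrite /over; case: ifP => // q0.
  apply: measurableD; first by apply: mgt; rewrite ler0q ltW.
  exact: bigcupT_measurable_rat.
apply/seteqP; split=> w.
  move=> /(exits_at_rat c_gt0 ltab (lipX w) (X0ab w))[q [q0 Xq Xr]].
  exists q => //; rewrite /over q0; split=> // -[r _].
  by rewrite /below; case: ifP => //= /Xr; rewrite leNgt => /negP.
move=> [q _]; rewrite /over; case: ifP => // q0 [Xq nbelow].
apply/(exits_at_rat c_gt0 ltab (lipX w) (X0ab w)); exists q; split=> // r rq.
rewrite leNgt; apply/negP => Xr; apply: nbelow; exists r => //.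
by rewrite /below rq.
Qed.

Lemma cvg_reversal_rate (h : nat -> R) : (forall n, 0 < h n) ->
    h n @[n --> \oo] --> 0 ->
  odd_prob (lambda * h n) / (c * h n) @[n --> \oo] --> lambda / c.
Proof.
move=> h0 h_cvg.
apply: (@squeeze_cvgr _ _ _ _ (fun n => lambda / c * (1 - lambda * h n))
  (fun=> lambda / c)).
- near=> n; have := h0 n => hn.
  have /andP[q0 q1] := odd_prob_bounds lambda_gt0 (telegraph_poisson telegraphX)
    (mulr_gt0 lambda_gt0 hn).
  have chn : 0 < c * h n by rewrite mulr_gt0.
  rewrite ler_pdivlMr// ler_pdivrMr//.
  rewrite (_ : lambda / c * _ * _ = lambda * h n * (1 - lambda * h n)); last first.
    by field; rewrite gt_eqF.
  rewrite q0 (_ : lambda / c * _ = lambda * h n)//.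
  by field; rewrite gt_eqF.
- rewrite -[X in _ --> X]mulr1; apply: cvgM; first exact: cvg_cst.
  rewrite -[X in _ --> X]subr0; apply: cvgB; first exact: cvg_cst.
  by rewrite -(mulr0 lambda); apply: cvgM => //; exact: cvg_cst.
- exact: cvg_cst.
Unshelve. all: by end_near. Qed.

(** The limit, as the time step tends to 0, of the bound on the probability
    that the walk crosses slightly lowered barriers. *)
Lemma exit_right_upper_bound (j : direction) :
  (P ([set w | D 0 w = j] `&` exits_at X a b b) <=
     (2^-1 * walk_harmonic a b 0 (lambda / c) x j)%:E)%E.
Proof.
pose de n : R := n.+1%:R^-1.
pose h n : R := n.+1%:R ^- 2.
have h0 n : 0 < h n by rewrite invr_gt0 exprn_gt0.
have de_cvg : de n @[n --> \oo] --> 0 by exact: cvg_harmonic.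
have hE : h = (fun n => de n * de n).
  by apply/funext => n; rewrite /h /de exprS expr1 invfM.
have h_cvg : h n @[n --> \oo] --> 0.
  by rewrite hE -[X in _ --> X](mulr0 0); exact: cvgM.
have mj : measurable [set w | D 0 w = j].
  exact: (measurable_preimage_eq j (telegraph_start_measurable telegraphX)).
apply: (@measure_eventually_le _ _ _ _ _
  (fun n => [set w | D 0 w = j] `&`
     [set w | crosses (a - de n) (b - de n) (c * h n) (n.+1 ^ 3).+1 x
        (fun i => D (i%:R * h n) w)])
  (fun n => 2^-1 * walk_harmonic (a - de n) (b - de n) (c * h n)
     (odd_prob (lambda * h n) / (c * h n)) x j)).
- by apply: measurableI => //; exact: measurable_exits_at.
- move=> n; apply: measurableI => //.
  apply: (@measurable_crosses _ _ _ _ _ _ _ _ (fun i => D (i%:R * h n))) => k.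
  exact: (measurable_grid telegraphX (h0 n)).
- move=> w [wj ew]; have cr := exits_at_crosses c_gt0 ltab xab (pathX w) ew.
  by near=> n; split=> //; near: n.
- move=> n; apply: (grid_crossing_bound c_gt0 telegraphX (h0 n)).
  + by rewrite ltrD2r.
  + by have /andP[ax _] := xab; rewrite lerBlDr ler_wpDr// invr_ge0.
- have g_cvg := cvg_reversal_rate h0 h_cvg.
  have c0 := ltW c_gt0.
  apply: cvgM; first exact: cvg_cst.
  have den : lambda / c * (b - a) + 1 != 0.
    rewrite gt_eqF// ltr_wpDl// mulr_ge0// ?subr_ge0 ?ltW//.
    exact: divr_gt0.
  apply: cvgM.
    apply: cvgD; last exact: cvg_cst.
    apply: cvgM => //.
    apply: cvgD; last by rewrite -(mulr0 c); apply: cvgM => //; exact: cvg_cst.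
    apply: cvgB; first exact: cvg_cst.
    by rewrite -[X in _ --> X]subr0; apply: cvgB => //; exact: cvg_cst.
  apply: cvgV => //.
  apply: cvgD; last exact: cvg_cst.
  apply: cvgM => //.
  by apply: cvgB; rewrite -[X in _ --> X]subr0;
    apply: cvgB => //; exact: cvg_cst.
Unshelve. all: by end_near. Qed.

(** An event-free time interval of length [L > (b - a) / c] carries the particle
    out of [[a, b]] wherever it started, and the intervals
    [[i * L, i.+1 * L]] are event-free independently with the same positive
    probability. *)
Lemma exit_almost_surely (j : direction) :
  measurable (exits_at X a b a) ->
  P ([set w | D 0 w = j] `\` (exits_at X a b b `|` exits_at X a b a)) = 0%E.
Proof.
move=> ma; have mb := measurable_exits_at.
have mj : measurable [set w | D 0 w = j].
  exact: (measurable_preimage_eq j (telegraph_start_measurable telegraphX)).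
pose L := (b - a) / c + 1.
have L0 : 0 < L by rewrite ltr_wpDl// divr_ge0 ?subr_ge0 ?ltW.
have cL : b - a < c * L.
  by rewrite mulrDr mulr1 mulrCA mulfV ?gt_eqF// mulr1 ltrDl.
pose r := 1 - expR (- (lambda * L)).
apply/eqP; rewrite eq_le measure_ge0 andbT.
apply: (@measure_eventually_le _ _ _ _ _
  (fun n => [set w | D 0 w = j] `&` [set w | forall i, (i < n)%N ->
     (N (i.+1%:R * L)%R w - N (i%:R * L)%R w)%N <> 0%N])
  (fun n => 2^-1 * r ^+ n)).
- by apply: measurableD => //; exact: measurableU.
- move=> n; apply: measurableI => //.
  rewrite (_ : [set w | _] = \bigcap_(i in [set i | (i < n)%N])
    [set w | (N (i.+1%:R * L)%R w - N (i%:R * L)%R w)%N <> 0%N])//.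
  apply: fin_bigcap_measurable => [|i _]; first exact: finite_II.
  apply: (measurable_increment (telegraph_poisson telegraphX)
     (fun k => k <> 0%N)); by rewrite mulr_ge0// ltW.
- move=> w [wj nexit]; apply: nearW => n; split=> // i _ NE.
  have Xin s : 0 < s -> a <= X s w <= b.
    move=> s0; apply: contrapT => /negP Xs; apply: nexit.
    have [t et _] := exit_time_exists s0 Xs.
    have [Xt|Xt] := exit_position c_gt0 (lipX w) (X0ab w) et.
      by right; exists t.
    by left; exists t.
  have Xin0 s : 0 <= s -> a <= X s w <= b.
    by rewrite le_eqVlt => /predU1P[<-//|]; exact: Xin.
  have iL : 0 <= i%:R * L by rewrite mulr_ge0// ltW.
  have iSL : i%:R * L <= i.+1%:R * L by rewrite ler_pM2r// ler_nat.
  have /andP[? ?] := Xin0 _ iL.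
  have /andP[? ?] := Xin0 _ (le_trans iL iSL).
  have : N (i%:R * L) w = N (i.+1%:R * L) w.
    apply/eqP; rewrite eqn_leq (path_nondecreasing (pathX w))//=.
    by rewrite -subn_eq0 NE.
  move=> /(path_linear c_gt0 (pathX w) iL iSL).
  rewrite -mulrBl -natrB// subSnn mul1r.
  by case: (D _ w); rewrite /sign_of ?mulrN1 ?mulr1 ?mulNr; lra.
- move=> n.
  rewrite (@start_independent_increments _ _ _ _ _ _ _ _ _ _ telegraphX j n
    (fun i => i%:R * L) (fun=> [set k | k <> 0%N])) ?mul0r//; last first.
    by move=> i k ik; rewrite ler_pM2r// ler_nat.
  rewrite (eq_bigr (fun=> r%:E)) => [|i _].
    by rewrite prodEFin prodr_const card_ord -EFinM.
  have iL : 0 <= i%:R * L by rewrite mulr_ge0// ltW.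
  have iSL : i%:R * L < i.+1%:R * L by rewrite ltr_pM2r// ltr_nat.
  rewrite -[X in P X]/(~` [set w | (N (i.+1%:R * L)%R w - N (i%:R * L)%R w)%N = 0%N]).
  rewrite probability_setC.
    rewrite (no_increment lambda_gt0 (telegraph_poisson telegraphX))//.
    by rewrite -mulrBl -natrB// subSnn mul1r.
  apply: (measurable_increment (telegraph_poisson telegraphX)
     (fun k => k = 0%N)) => //; exact: le_trans (ltW iSL).
- rewrite -(mulr0 2^-1); apply: cvgM; first exact: cvg_cst.
  apply: cvg_expr; rewrite ger0_norm /r.
    by rewrite gtrBl expR_gt0.
  by rewrite subr_ge0 expR_le1 oppr_le0 mulr_ge0// ltW.
Qed.

End ExitProbability.

(** * The exit probabilities *)

(** Reflection exchanges the two initial directions, which are equally likely,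
    and keeps the Poisson process. *)
Lemma telegraph_mirror {R : realType} {dd : measure_display}
    {Omega : measurableType dd} (P : probability Omega R) (lambda c x : R) N D X :
    0 < c -> telegraph_process P lambda c x N D X ->
  telegraph_process P lambda c (- x) N (fun t w => ~~ D t w)
    (fun t w => - X t w).
Proof.
move=> c0 tX; have pN := telegraph_poisson tX; split.
- by [].
- exact: (measurableT_comp _ (telegraph_start_measurable tX)).
- move=> j; rewrite -(telegraph_start_law tX (~~ j)); congr (P _).
  by apply/seteqP; split=> w /=; [move=> <-; rewrite negbK|move=> ->; rewrite negbK].
- move=> A B [S mS <-] GB; apply: (telegraph_independence tX) => //.
  by exists (negb @^-1` S).
- by move=> w t t0; rewrite !iter_negb (telegraph_directionE tX w t0) addbN.
- move=> w t t0; rewrite (telegraph_position tX)// opprD; congr (_ + _).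
  have := integrable_velocity c0 (telegraph_pathwise tX w) t => iv.
  rewrite -mulN1r -RintegralZl//; apply: eq_Rintegral => s _.
  by case: (D s w); rewrite /sign_of /= mulN1r ?mulrN1 ?mulr1 ?opprK.
Qed.

Lemma exits_at_mirror {R : realType} {Omega : Type} (X : R -> Omega -> R)
    (a b y : R) :
  exits_at (fun t w => - X t w) (- b) (- a) (- y) = exits_at X a b y.
Proof.
have et w : exit_time (fun t w => - X t w) (- b) (- a) w = exit_time X a b w.
  rewrite /exit_time; congr (ereal_inf [set t%:E | t in _]).
  by apply/seteqP; split=> t /=; rewrite !in_itv/= !lerN2 andbC.
apply/seteqP; split=> w [t]; rewrite ?et => wt Xt; exists t; rewrite ?et//.
  exact: oppr_inj.
by rewrite Xt.
Qed.

Section Formula.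
Context {R : realType} {dd : measure_display} {Omega : measurableType dd}.
Variables (P : probability Omega R) (lambda c a b x : R).
Variables (N : R -> Omega -> nat) (D : R -> Omega -> direction).
Variable X : R -> Omega -> R.
Hypotheses (lambda_gt0 : 0 < lambda) (c_gt0 : 0 < c) (ltab : a < b).
Hypothesis xab : a <= x <= b.
Hypothesis telegraphX : telegraph_process P lambda c x N D X.

(** The upper bounds for leaving through [b] and, by reflection, through [a] add
    up to the probability of starting in direction [j], which is also the sum of
    the two probabilities as the particle leaves almost surely; hence both
    bounds are equalities. *)
Lemma exits_at_start_prob (j : direction) :
  P ([set w | D 0 w = j] `&` exits_at X a b b) =
  (2^-1 * walk_harmonic a b 0 (lambda / c) x j)%:E.
Proof.
have mirX := telegraph_mirror c_gt0 telegraphX.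
have ltba : - b < - a by rewrite ltrN2.
have xba : - b <= - x <= - a by rewrite !lerN2 andbC.
have mb := measurable_exits_at c_gt0 ltab xab telegraphX.
have ma := measurable_exits_at c_gt0 ltba xba mirX.
have := exit_right_upper_bound lambda_gt0 c_gt0 ltba xba mirX (~~ j).
rewrite exits_at_mirror in ma *.
have := exit_right_upper_bound lambda_gt0 c_gt0 ltab xab telegraphX j.
have mj : measurable [set w | D 0 w = j].
  exact: (measurable_preimage_eq j (telegraph_start_measurable telegraphX)).
have -> : [set w | ~~ D 0 w = ~~ j] = [set w | D 0 w = j].
  by apply/seteqP; split=> w /= => [/negb_inj|->].
set J := [set w | D 0 w = j] => leb lea.
have half : (P (J `&` exits_at X a b b) + P (J `&` exits_at X a b a) = (2^-1)%:E)%E.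
  rewrite -(telegraph_start_law telegraphX j) -/J.
  rewrite -measureU; [|exact: measurableI|exact: measurableI|].
    have mE := measurableU _ _ mb ma.
    rewrite -setIUr -[LHS]add0e.
    rewrite -(exit_almost_surely lambda_gt0 c_gt0 ltab xab telegraphX j ma).
    exact/esym/(measureDI P mj mE).
  apply/seteqP; split=> w // [[_ [t et Xt]] [_ [s es Xs]]] /=.
  move: et; rewrite es => -[st]; move: Xs Xt; rewrite st => -> ab.
  by move: ltab; rewrite ab ltxx.
move: half leb lea.
have -> : P (J `&` exits_at X a b b) = (fine (P (J `&` exits_at X a b b)))%:E.
  by rewrite fineK// fin_num_measure//; exact: measurableI.
have -> : P (J `&` exits_at X a b a) = (fine (P (J `&` exits_at X a b a)))%:E.
  by rewrite fineK// fin_num_measure//; exact: measurableI.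
rewrite -EFinD !lee_fin => -[half] leb lea; congr EFin.
have den : 0 < lambda / c * (b - a) + 1.
  by rewrite ltr_wpDl// mulr_ge0// ?subr_ge0 ?ltW// divr_gt0.
have den0 : lambda / c * (b - a) + 1 != 0 by rewrite gt_eqF.
have sum1 : walk_harmonic a b 0 (lambda / c) x j +
    walk_harmonic (- b) (- a) 0 (lambda / c) (- x) (~~ j) = 1.
  rewrite /walk_harmonic (_ : - a - - b = b - a); last by ring.
  rewrite -mulrDl -[RHS](divff den0); congr (_ / _).
  by case: j {J leb lea half mj}; rewrite /d0 /=; ring.
move: half leb lea sum1.
set u := fine _; set v := fine _; set p := walk_harmonic _ _ _ _ _ _.
set r := walk_harmonic _ _ _ _ _ _; lra.
Qed.

Lemma walk_harmonicE (j : direction) :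
  walk_harmonic a b 0 (lambda / c) x j =
  (c * (j == d0)%:R + lambda * (x - a)) / (c + lambda * (b - a)).
Proof.
have den : 0 < c + lambda * (b - a).
  by rewrite ltr_wpDr// mulr_ge0// ?subr_ge0 ltW.
rewrite /walk_harmonic addr0; field.
by rewrite !gt_eqF.
Qed.

End Formula.

Unset Implicit Arguments.

Theorem theorem1 (R : realType) (dd : measure_display)
    (Omega : measurableType dd) (P : probability Omega R)
    (lambda c a b x : R)
    (N : R -> Omega -> nat) (D : R -> Omega -> direction)
    (X : R -> Omega -> R)
    (lambda_gt0 : 0 < lambda) (c_gt0 : 0 < c) (ltab : a < b)
    (xab : x \in `[a, b])
    (telegraph : telegraph_process P lambda c x N D X) :
  let u0 := exit_right_given P D X a b d0 in
  let u1 := exit_right_given P D X a b d1 in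
  let u := exit_right P X a b in
  [/\ u0 = (c + lambda * (x - a)) / (c + lambda * (b - a)),
      u1 = (lambda * (x - a)) / (c + lambda * (b - a)),
      u = (u0 + u1) / 2 &
      u = 1 / 2 * ((c + 2 * lambda * (x - a)) / (c + lambda * (b - a)))].
Proof.
move=> u0 u1 u; rewrite in_itv/= in xab.
have Pj := exits_at_start_prob lambda_gt0 c_gt0 ltab xab telegraph.
have uj j : exit_right_given P D X a b j =
    (c * (j == d0)%:R + lambda * (x - a)) / (c + lambda * (b - a)).
  rewrite /exit_right_given /cond_prob setIC Pj (telegraph_start_law telegraph)/=.
  by rewrite mulrAC divff ?mul1r ?walk_harmonicE// invr_neq0.
have u0E : u0 = (c + lambda * (x - a)) / (c + lambda * (b - a)).
  by rewrite /u0 uj eqxx mulr1.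
have u1E : u1 = (lambda * (x - a)) / (c + lambda * (b - a)).
  by rewrite /u1 uj /= mulr0 add0r.
have uE : u = (u0 + u1) / 2.
  have mb := measurable_exits_at c_gt0 ltab xab telegraph.
  have mD := telegraph_start_measurable telegraph.
  have -> : u = fine (P ([set w | D 0%R w = d0] `&` exits_at X a b b) +
                      P ([set w | D 0%R w = d1] `&` exits_at X a b b))%E.
    rewrite /u /exit_right; congr fine; rewrite -measureU.
    - congr (P _); apply/seteqP; split=> w /=; last by move=> [[]|[]].
      by move=> ew; case Dw : (D 0 w); [right|left].
    - exact: measurableI (measurable_preimage_eq d0 mD) mb.
    - exact: measurableI (measurable_preimage_eq d1 mD) mb.
    - by apply/seteqP; split=> w //= -[[-> _] []].
  rewrite !Pj -EFinD /= -mulrDr mulrC; congr (_ * _).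
  by rewrite /u0 /u1 !uj !walk_harmonicE.
split=> //; rewrite uE u0E u1E -mulrDl mulrC mul1r; congr (_ * (_ / _)).
ring.
Qed.
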